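(* Let $M^2$ be a helicoidal surface (of first type) in the isotropic 3-space $\mathbb{I}^3$, parametrized by $\mathbf{r}(u,v)=(u\cos v,\,u\sin v,\,g(u)+hv)$ with $h\in\mathbb{R}$. Then the parameter curves (the curves $u=\mathrm{const.}$ and the curves $v=\mathrm{const.}$) on $M^2$ are lines of curvature if and only if $M^2$ is a surface of revolution, i.e. $h=0$.
   Context: The isotropic 3-space $\mathbb{I}^3$ is $\mathbb{R}^3$ with affine coordinates $(x_1,x_2,x_3)$ and the degenerate isotropic metric $dx_1^2+dx_2^2$ (the Euclidean metric of the top view $(x_1,x_2,x_3)\mapsto(x_1,x_2,0)$). In the parametrization $\mathbf{r}$, $u$ ranges over an interval not containing $0$ and $g$ is of class $C^2$. The number $h$ is the pitch; in case $h=0$ the helicoidal surface is called a surface of revolution in $\mathbb{I}^3$. Let $\mathbf{r}(s)=\mathbf{r}(u(s),v(s))$ be a curve on $M^2$ parametrized by arc length $s$ with respect to the isotropic metric (i.e. the top view has Euclidean unit speed), and let a dot denote $d/ds$. Let $\mathbf{t}=\dot{\mathbf{r}}=(t_1,t_2,t_3)$ be its tangent vector, and let $\sigma=(\sigma_1,\sigma_2,\sigma_3)$ be the side tangential vector: the vector in the tangent plane of $M^2$ with $\sigma_1^2+\sigma_2^2=1$, $\sigma_1t_1+\sigma_2t_2=0$, $t_1\sigma_2-t_2\sigma_1=1$. Put $\mathbf{N}=(0,0,1)$. The decompositions $\ddot{\mathbf{r}}=\kappa_g\sigma+\kappa_n\mathbf{N}$ and $\dot{\sigma}=-\kappa_g\mathbf{t}+\tau_g\mathbf{N}$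 define the geodesic curvature $\kappa_g$, the normal curvature $\kappa_n$ and the geodesic torsion $\tau_g$ of the curve on $M^2$. The curve is called a line of curvature if $\tau_g$ vanishes. *)

(* Defs.v *)
From Stdlib Require Import Reals.
From Coquelicot Require Import Coquelicot.
Open Scope R_scope.

(** Isotropic 3-space in affine coordinates; [plus] and [scal] are Coquelicot's
    componentwise operations on products. *)
Definition I3 : Type := (R * R * R)%type.
Definition x1 (p : I3) : R := fst (fst p).
Definition x2 (p : I3) : R := snd (fst p).
Definition x3 (p : I3) : R := snd p.

Definition N : I3 := (0, 0, 1).

(** Inner product of the degenerate metric dx1^2 + dx2^2. *)
Definition iso_dot (p q : I3) : R := x1 p * x1 q + x2 p * x2 q.

(** Nondegenerate, but otherwise arbitrary: open, half-open, closed, bounded or not. *)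
Definition interval (J : R -> Prop) : Prop :=
  (forall x y z, J x -> J y -> x <= z <= y -> J z) /\
  (exists x y, J x /\ J y /\ x < y).

(** Derivatives are taken relative to the domain ([D_in]), hence are one-sided at
    an end point belonging to it; nothing depends on values outside the domain. *)
Definition class_C2 (D : R -> Prop) (f : R -> R) : Prop :=
  exists f1 f2 : R -> R, forall x, D x ->
    D_in f f1 D x /\ D_in f1 f2 D x /\ continue_in f2 D x.

Definition is_vderiv (D : R -> Prop) (f : R -> I3) (x : R) (l : I3) : Prop :=
  D_in (fun y => x1 (f y)) (fun _ => x1 l) D x /\
  D_in (fun y => x2 (f y)) (fun _ => x2 l) D x /\
  D_in (fun y => x3 (f y)) (fun _ => x3 l) D x.

(** [w] lies in the span of the partial derivatives at (u, v) of the surface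
    [X] parametrized over the product [A] x [B]. *)
Definition in_tangent_plane (X : R -> R -> I3) (A B : R -> Prop)
    (u v : R) (w : I3) : Prop :=
  exists Xu Xv : I3,
    is_vderiv A (fun u' => X u' v) u Xu /\
    is_vderiv B (fun v' => X u v') v Xv /\
    exists a b : R, w = plus (scal a Xu) (scal b Xv).

Record arc_length_curve (X : R -> R -> I3) (A B : R -> Prop)
    (J : R -> Prop) (u v : R -> R) : Prop := {
  alc_dom : interval J;
  alc_on : forall s, J s -> A (u s) /\ B (v s);
  alc_u : class_C2 J u;
  alc_v : class_C2 J v;
  alc_unit : forall s, J s -> exists t : I3,
    is_vderiv J (fun s' => X (u s') (v s')) s t /\ iso_dot t t = 1
}.

Record darboux (X : R -> R -> I3) (A B : R -> Prop)
    (J : R -> Prop) (u v : R -> R)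
    (t sigma : R -> I3) (kg kn tg : R -> R) : Prop := {
  darboux_t : forall s, J s -> is_vderiv J (fun s' => X (u s') (v s')) s (t s);
  darboux_plane : forall s, J s ->
    in_tangent_plane X A B (u s) (v s) (sigma s);
  darboux_unit : forall s, J s -> iso_dot (sigma s) (sigma s) = 1;
  darboux_orth : forall s, J s -> iso_dot (sigma s) (t s) = 0;
  darboux_orient : forall s, J s ->
    x1 (t s) * x2 (sigma s) - x2 (t s) * x1 (sigma s) = 1;
  darboux_dt : forall s, J s ->
    is_vderiv J t s (plus (scal (kg s) (sigma s)) (scal (kn s) N));
  darboux_dsigma : forall s, J s ->
    is_vderiv J sigma s (plus (scal (- kg s) (t s)) (scal (tg s) N))
}.

(** On [J] the data [t], [sigma], [kg], [kn], [tg] are determined by the curve;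
    stating their existence makes the predicate fail, rather than hold
    vacuously, when the geodesic torsion is undefined. *)
Definition line_of_curvature (X : R -> R -> I3) (A B : R -> Prop)
    (J : R -> Prop) (u v : R -> R) : Prop :=
  exists (t sigma : R -> I3) (kg kn tg : R -> R),
    darboux X A B J u v t sigma kg kn tg /\ forall s, J s -> tg s = 0.

(** Every arc of a parameter curve, in either orientation. *)
Definition parameter_curves_are_lines_of_curvature
    (X : R -> R -> I3) (A B : R -> Prop) : Prop :=
  forall (J : R -> Prop) (u v : R -> R),
    arc_length_curve X A B J u v ->
    ((exists c, forall s, J s -> u s = c) \/
     (exists c, forall s, J s -> v s = c)) ->
    line_of_curvature X A B J u v.

Definition helicoidal (g : R -> R) (h : R) (u v : R) : I3 :=
  (u * cos v, u * sin v, g u + h * v).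

(* Main.v *)
Require Import Defs.
From Stdlib Require Import Reals Lra.
Open Scope R_scope.

(** Write a parameter curve with unit speed as (u(s), v(s)). Differentiating the
    unit-speed relation u'^2 + u^2 v'^2 = 1 shows that the non-constant parameter
    is affine in s. A curve v = const has kappa_g = 0 and sigma = (u'/u) r_v, so
    tau_g = (h u'/u)', which is zero for h = 0. A curve u = c has kappa_g = v',
    sigma = - c v' r_u with constant third component, and t_3 = h v', so
    tau_g = kappa_g t_3 = h / c^2. Hence already the curve v = s/c on u = c
    forces h = 0. *)

(** * Calculus of derivatives relative to a domain *)

Definition deriv_in (D : R -> Prop) (f : R -> R) (x l : R) : Prop :=
  D_in f (fun _ => l) D x.

(** The difference quotient samples [f] only at points of [D]. Keeping [l = l'] as a separate
    premise lets a calculus rule supply the derivative in raw form and leaves its simplification to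
    [ring]. *)
Lemma deriv_in_ext (D : R -> Prop) (f f' : R -> R) (x l l' : R) :
  D x -> (forall y, D y -> f y = f' y) -> l = l' ->
  deriv_in D f x l -> deriv_in D f' x l'.
Proof.
  intros Dx Hf -> H e He.
  destruct (H e He) as [d [Hd H']].
  exists d; split; [exact Hd|].
  intros y Hy.
  specialize (H' y Hy).
  rewrite <- (Hf y), <- (Hf x); [exact H'|exact Dx|].
  apply Hy.
Qed.

(** Nondegeneracy supplies a point [y] other than [x], and convexity then puts points between [x]
    and [y] at distance at most [e / 2] from [x]. This is what makes relative derivatives unique,
    also at end points. *)
Lemma interval_accumulation (D : R -> Prop) (x : R) :
  interval D -> D x -> adhDa (D_x D x) x.
Proof.
  intros [conv [a [b [Da [Db ab]]]]] Dx e He.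
  assert (exists y, D y /\ y <> x) as [y [Dy yx]].
  { destruct (Req_dec a x) as [<-|ne]; [exists b|exists a]; split; auto; lra. }
  destruct (Rlt_or_le x y) as [xy|xy].
  - exists (Rmin y (x + e / 2)).
    assert (x < Rmin y (x + e / 2)) by (apply Rmin_glb_lt; lra).
    pose proof (Rmin_l y (x + e / 2)).
    pose proof (Rmin_r y (x + e / 2)).
    split; [split|].
    + apply (conv x y); auto; lra.
    + lra.
    + unfold Rdist; apply Rabs_def1; lra.
  - exists (Rmax y (x - e / 2)).
    assert (Rmax y (x - e / 2) < x) by (apply Rmax_lub_lt; lra).
    pose proof (Rmax_l y (x - e / 2)).
    pose proof (Rmax_r y (x - e / 2)).
    split; [split|].
    + apply (conv y x); auto; lra.
    + lra.
    + unfold Rdist; apply Rabs_def1; lra.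
Qed.

Lemma deriv_in_unique (D : R -> Prop) (f : R -> R) (x l l' : R) :
  interval D -> D x -> deriv_in D f x l -> deriv_in D f x l' -> l = l'.
Proof.
  intros HD Dx H H'.
  exact (single_limit _ _ _ _ _ (interval_accumulation D x HD Dx) H H').
Qed.

Lemma deriv_in_const (D : R -> Prop) (c x : R) : deriv_in D (fun _ => c) x 0.
Proof. exact (Dconst D c x). Qed.

Lemma deriv_in_id (D : R -> Prop) (x : R) : deriv_in D (fun y => y) x 1.
Proof. exact (Dx D x). Qed.

Lemma deriv_in_plus (D : R -> Prop) (f f' : R -> R) (x l l' : R) :
  deriv_in D f x l -> deriv_in D f' x l' ->
  deriv_in D (fun y => f y + f' y) x (l + l').
Proof. exact (Dadd D _ _ f f' x). Qed.

Lemma deriv_in_mult (D : R -> Prop) (f f' : R -> R) (x l l' : R) :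
  deriv_in D f x l -> deriv_in D f' x l' ->
  deriv_in D (fun y => f y * f' y) x (l * f' x + f x * l').
Proof. exact (Dmult D _ _ f f' x). Qed.

(** [Dcomp] differentiates over the points of [D] that [f] sends into [E]; the first premise makes
    these all of [D]. *)
Lemma deriv_in_comp (D E : R -> Prop) (f f' : R -> R) (x l l' : R) :
  (forall y, D y -> E (f y)) ->
  deriv_in D f x l -> deriv_in E f' (f x) l' ->
  deriv_in D (fun y => f' (f y)) x (l' * l).
Proof.
  intros DE H H'.
  rewrite Rmult_comm.
  intros e He.
  destruct (Dcomp _ _ _ _ _ _ _ H H' e He) as [d [Hd K]].
  exists d; split; [exact Hd|].
  intros y [[Dy yx] yd].
  apply K; split; [|exact yd].
  split; [split; auto|exact yx].
Qed.

Lemma deriv_in_cos (D : R -> Prop) (f : R -> R) (x l : R) :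
  deriv_in D f x l -> deriv_in D (fun y => cos (f y)) x (- sin (f x) * l).
Proof.
  intros H.
  apply (deriv_in_comp D no_cond); [exact (fun _ _ => Logic.I)|exact H|].
  apply derivable_pt_lim_D_in, derivable_pt_lim_cos.
Qed.

Lemma deriv_in_sin (D : R -> Prop) (f : R -> R) (x l : R) :
  deriv_in D f x l -> deriv_in D (fun y => sin (f y)) x (cos (f x) * l).
Proof.
  intros H.
  apply (deriv_in_comp D no_cond); [exact (fun _ _ => Logic.I)|exact H|].
  apply derivable_pt_lim_D_in, derivable_pt_lim_sin.
Qed.

(** * Velocities on the surface and the unit-speed relation *)

Lemma I3_eq (p q : I3) : x1 p = x1 q -> x2 p = x2 q -> x3 p = x3 q -> p = q.
Proof.
  destruct p as [[p1 p2] p3], q as [[q1 q2] q3]; cbn.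
  intros -> -> ->; reflexivity.
Qed.

Lemma is_vderiv_unique (D : R -> Prop) (f : R -> I3) (x : R) (l l' : I3) :
  interval D -> D x -> is_vderiv D f x l -> is_vderiv D f x l' -> l = l'.
Proof.
  intros HD Dx [H1 [H2 H3]] [H1' [H2' H3']].
  apply I3_eq; eapply deriv_in_unique; eassumption.
Qed.

Lemma cos_sin_sqr (x : R) : cos x * cos x = 1 - sin x * sin x.
Proof. pose proof (sin2_cos2 x) as H; unfold Rsqr in H; lra. Qed.

(** Chain rule for an arbitrary pair of coordinate functions. With one of them the identity and the
    other constant, the same formula yields both partial derivatives. *)
Lemma helicoidal_velocity (A D : R -> Prop) (g u v : R -> R) (h s g' u' v' : R) :
  (forall y, D y -> A (u y)) -> D s ->
  deriv_in A g (u s) g' -> deriv_in D u s u' -> deriv_in D v s v' ->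
  is_vderiv D (fun y => helicoidal g h (u y) (v y)) s
    (u' * cos (v s) - u s * v' * sin (v s),
     u' * sin (v s) + u s * v' * cos (v s),
     g' * u' + h * v').
Proof.
  intros DA Ds Hg Hu Hv.
  split; [|split]; cbn.
  - refine (deriv_in_ext _ _ _ _ _ _ Ds (fun _ _ => eq_refl) _
      (deriv_in_mult _ _ _ _ _ _ Hu (deriv_in_cos _ _ _ _ Hv))); cbn; ring.
  - refine (deriv_in_ext _ _ _ _ _ _ Ds (fun _ _ => eq_refl) _
      (deriv_in_mult _ _ _ _ _ _ Hu (deriv_in_sin _ _ _ _ Hv))); cbn; ring.
  - refine (deriv_in_ext _ _ _ _ _ _ Ds (fun _ _ => eq_refl) _
      (deriv_in_plus _ _ _ _ _ _ (deriv_in_comp _ _ _ _ _ _ _ DA Hu Hg)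
        (deriv_in_mult _ _ _ _ _ _ (deriv_in_const _ h s) Hv))); cbn; ring.
Qed.

Lemma helicoidal_partial_u (A : R -> Prop) (g : R -> R) (h u v g' : R) :
  A u -> deriv_in A g u g' ->
  is_vderiv A (fun u' => helicoidal g h u' v) u (cos v, sin v, g').
Proof.
  intros Au Hg.
  pose proof (helicoidal_velocity A A g (fun y => y) (fun _ => v) h u g' 1 0
    (fun _ H => H) Au Hg (deriv_in_id A u) (deriv_in_const A v u)) as H.
  cbn in H.
  replace (cos v, sin v, g') with
    (1 * cos v - u * 0 * sin v, 1 * sin v + u * 0 * cos v, g' * 1 + h * 0)
    by (apply I3_eq; cbn; ring).
  exact H.
Qed.

Lemma helicoidal_partial_v (A : R -> Prop) (g : R -> R) (h u v g' : R) :
  A u -> deriv_in A g u g' ->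
  is_vderiv (fun _ => True) (fun v' => helicoidal g h u v') v
    (- u * sin v, u * cos v, h).
Proof.
  intros Au Hg.
  pose proof (helicoidal_velocity A (fun _ => True) g (fun _ => u) (fun y => y)
    h v g' 0 1 (fun _ _ => Au) Logic.I Hg (deriv_in_const _ u v)
    (deriv_in_id _ v)) as H.
  cbn in H.
  replace (- u * sin v, u * cos v, h) with
    (0 * cos v - u * 1 * sin v, 0 * sin v + u * 1 * cos v, g' * 0 + h * 1)
    by (apply I3_eq; cbn; ring).
  exact H.
Qed.

(** In the top view, [u] and [v] are polar coordinates, so the isotropic metric reads du^2 + u^2
    dv^2; [g] and [h] enter only the third component, which [iso_dot] ignores. *)
Lemma helicoidal_unit_speed (A B J : R -> Prop) (g g1 u v u1 v1 : R -> R) (h : R) :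
  (forall x, A x -> deriv_in A g x (g1 x)) ->
  arc_length_curve (helicoidal g h) A B J u v ->
  (forall s, J s -> deriv_in J u s (u1 s)) ->
  (forall s, J s -> deriv_in J v s (v1 s)) ->
  forall s, J s -> u1 s * u1 s + (u s * v1 s) * (u s * v1 s) = 1.
Proof.
  intros Hg [HJ on _ _ unit] Hu Hv s Js.
  destruct (unit s Js) as [t [Ht tt]].
  pose proof (helicoidal_velocity A J g u v h s _ _ _
    (fun y Jy => proj1 (on y Jy)) Js (Hg _ (proj1 (on s Js))) (Hu s Js) (Hv s Js))
    as Ht'.
  rewrite (is_vderiv_unique _ _ _ _ _ HJ Js Ht Ht') in tt.
  unfold iso_dot, x1, x2 in tt; cbn in tt.
  pose proof (cos_sin_sqr (v s)) as cs.
  rewrite <- tt.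
  ring_simplify.
  replace (cos (v s) ^ 2) with (1 - sin (v s) * sin (v s))
    by (rewrite <- cs; ring).
  ring.
Qed.

(** Differentiating w^2 = k gives 2 w w' = 0, and k <> 0 keeps [w] away from 0. Applied to a
    parameter speed, it removes the second derivative without deciding the sign of the speed. *)
Lemma deriv_constant_square (J : R -> Prop) (w : R -> R) (k s w' : R) :
  interval J -> J s -> k <> 0 -> (forall y, J y -> w y * w y = k) ->
  deriv_in J w s w' -> w' = 0.
Proof.
  intros HJ Js k0 wk Hw.
  pose proof (deriv_in_mult _ _ _ _ _ _ Hw Hw) as H.
  assert (deriv_in J (fun y => w y * w y) s 0) as H0.
  { refine (deriv_in_ext _ _ _ _ _ _ Js _ eq_refl (deriv_in_const J k s)).
    intros y Jy; symmetry; auto. }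
  pose proof (deriv_in_unique _ _ _ _ _ HJ Js H H0) as E.
  assert (w s <> 0).
  { intros E0; apply k0; rewrite <- (wk s Js), E0; ring. }
  apply (Rmult_eq_reg_l (w s)); [lra|assumption].
Qed.

(** * Parallels and meridians of a surface of revolution *)

(** For pitch 0 the tangent of a parallel is horizontal, and the third component of sigma = -(c v')
    r_u has derivative 0. The third component of the equation for the derivative of sigma thus reads
    0 = tau_g. *)
Lemma parallel_line_of_curvature (A J : R -> Prop) (g u v : R -> R) (c : R) :
  ~ A 0 -> class_C2 A g ->
  arc_length_curve (helicoidal g 0) A (fun _ => True) J u v ->
  (forall s, J s -> u s = c) ->
  line_of_curvature (helicoidal g 0) A (fun _ => True) J u v.
Proof.
  intros A0 [g1 [g2 Hg]] curve uc.
  pose proof (alc_dom _ _ _ _ _ _ curve) as HJ.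
  pose proof (alc_on _ _ _ _ _ _ curve) as on.
  destruct (alc_v _ _ _ _ _ _ curve) as [v1 [v2 Hv]].
  (* [D_in] uses the derivative function only through its value at the point, so [D_in g g1 A x] is
     convertible to [deriv_in A g x (g1 x)]. *)
  assert (forall x, A x -> deriv_in A g x (g1 x)) as Hg1 by apply Hg.
  assert (forall s, J s -> deriv_in J v s (v1 s)) as Hv1 by apply Hv.
  assert (forall s, J s -> deriv_in J u s 0) as Hu1.
  { intros s Js.
    refine (deriv_in_ext _ _ _ _ _ _ Js _ eq_refl (deriv_in_const J c s)).
    intros y Jy; symmetry; auto. }
  pose proof (helicoidal_unit_speed _ _ _ _ _ _ _ (fun _ => 0) _ _
    Hg1 curve Hu1 Hv1) as unit.
  assert (forall s, J s -> (c * v1 s) * (c * v1 s) = 1) as unit'.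
  { intros s Js; pose proof (unit s Js) as E; rewrite (uc s Js) in E; lra. }
  assert (forall s, J s -> A c) as Ac.
  { intros s Js; rewrite <- (uc s Js); apply on, Js. }
  assert (forall s, J s -> c <> 0) as c0.
  { intros s Js ->; exact (A0 (Ac s Js)). }
  assert (forall s, J s -> deriv_in J v1 s 0) as Hv2.
  { intros s Js.
    assert (deriv_in J v1 s (v2 s)) as H by (apply Hv, Js).
    (* By [unit'], (c v')^2 = 1, so v'^2 has the constant value 1/c^2. *)
    rewrite <- (deriv_constant_square J v1 (/ c * / c) s (v2 s) HJ Js); auto.
    - apply Rmult_integral_contrapositive; split;
        apply Rinv_neq_0_compat, (c0 s Js).
    - intros y Jy.
      transitivity (/ c * / c * ((c * v1 y) * (c * v1 y))).
      + field; exact (c0 s Js).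
      + rewrite unit'; [ring|exact Jy]. }
  assert (forall s, J s -> deriv_in J (fun y => c * v1 y) s 0) as Hcv.
  { intros s Js.
    refine (deriv_in_ext _ _ _ _ _ _ Js (fun _ _ => eq_refl) _
      (deriv_in_mult _ _ _ _ _ _ (deriv_in_const J c s) (Hv2 s Js))); ring. }
  exists (fun s => (- (c * v1 s) * sin (v s), c * v1 s * cos (v s), 0)).
  exists (fun s => (- (c * v1 s) * cos (v s), - (c * v1 s) * sin (v s),
                    - (c * v1 s) * g1 c)).
  (* The top view of t' is v' times that of sigma, which gives kappa_g. As t_3 = 0, kappa_n must
     cancel the third component of kappa_g sigma. *)
  exists v1, (fun s => c * v1 s * v1 s * g1 c), (fun _ => 0).
  split; [|reflexivity].
  assert (forall s, J s -> deriv_in J (fun y => - (c * v1 y)) s 0) as Hncv.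
  { intros s Js.
    refine (deriv_in_ext _ _ _ _ _ _ Js _ _
      (deriv_in_mult _ _ _ _ _ _ (deriv_in_const J (-1) s) (Hcv s Js)));
      intros; ring. }
  constructor; intros s Js.
  - pose proof (helicoidal_velocity A J g u v 0 s _ _ _
      (fun y Jy => proj1 (on y Jy)) Js (Hg1 _ (proj1 (on s Js)))
      (Hu1 s Js) (Hv1 s Js)) as H.
    rewrite (uc s Js) in H.
    match type of H with is_vderiv _ _ _ ?p =>
      replace (- (c * v1 s) * sin (v s), c * v1 s * cos (v s), 0) with p
        by (apply I3_eq; cbn; ring) end.
    exact H.
  - exists (cos (v s), sin (v s), g1 c), (- c * sin (v s), c * cos (v s), 0).
    rewrite (uc s Js).
    split; [|split].
    + apply helicoidal_partial_u; [exact (Ac s Js)|apply Hg1, (Ac s Js)].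
    + apply (helicoidal_partial_v A _ _ _ _ (g1 c));
        [exact (Ac s Js)|apply Hg1, (Ac s Js)].
    + exists (- (c * v1 s)), 0.
      apply I3_eq; cbn; ring.
  - unfold iso_dot, x1, x2; cbn.
    transitivity ((c * v1 s) * (c * v1 s) *
      (cos (v s) * cos (v s) + sin (v s) * sin (v s))); [ring|].
    rewrite unit', cos_sin_sqr by exact Js; ring.
  - unfold iso_dot, x1, x2; cbn; ring.
  - unfold x1, x2; cbn.
    transitivity ((c * v1 s) * (c * v1 s) *
      (cos (v s) * cos (v s) + sin (v s) * sin (v s))); [ring|].
    rewrite unit', cos_sin_sqr by exact Js; ring.
  - split; [|split]; cbn.
    + refine (deriv_in_ext _ _ _ _ _ _ Js (fun _ _ => eq_refl) _
        (deriv_in_mult _ _ _ _ _ _ (Hncv s Js) (deriv_in_sin _ _ _ _ (Hv1 s Js))));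
        cbn; ring.
    + refine (deriv_in_ext _ _ _ _ _ _ Js (fun _ _ => eq_refl) _
        (deriv_in_mult _ _ _ _ _ _ (Hcv s Js) (deriv_in_cos _ _ _ _ (Hv1 s Js))));
        cbn; ring.
    + refine (deriv_in_ext _ _ _ _ _ _ Js (fun _ _ => eq_refl) _
        (deriv_in_const _ 0 s)); cbn; ring.
  - split; [|split]; cbn.
    + refine (deriv_in_ext _ _ _ _ _ _ Js (fun _ _ => eq_refl) _
        (deriv_in_mult _ _ _ _ _ _ (Hncv s Js) (deriv_in_cos _ _ _ _ (Hv1 s Js))));
        cbn; ring.
    + refine (deriv_in_ext _ _ _ _ _ _ Js (fun _ _ => eq_refl) _
        (deriv_in_mult _ _ _ _ _ _ (Hncv s Js) (deriv_in_sin _ _ _ _ (Hv1 s Js))));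
        cbn; ring.
    + refine (deriv_in_ext _ _ _ _ _ _ Js (fun _ _ => eq_refl) _
        (deriv_in_mult _ _ _ _ _ _ (Hncv s Js) (deriv_in_const _ (g1 c) s)));
        cbn; ring.
Qed.

(** Here u'^2 = 1, hence u'' = 0. For pitch 0, r_v is horizontal, so sigma = (u'/u) r_v is u' times
    a fixed horizontal vector and has derivative 0; both kappa_g and tau_g vanish. *)
Lemma meridian_line_of_curvature (A J : R -> Prop) (g u v : R -> R) (c : R) :
  ~ A 0 -> class_C2 A g ->
  arc_length_curve (helicoidal g 0) A (fun _ => True) J u v ->
  (forall s, J s -> v s = c) ->
  line_of_curvature (helicoidal g 0) A (fun _ => True) J u v.
Proof.
  intros A0 [g1 [g2 Hg]] curve vc.
  pose proof (alc_dom _ _ _ _ _ _ curve) as HJ.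
  pose proof (alc_on _ _ _ _ _ _ curve) as on.
  destruct (alc_u _ _ _ _ _ _ curve) as [u1 [u2 Hu]].
  assert (forall x, A x -> deriv_in A g x (g1 x)) as Hg1 by apply Hg.
  assert (forall s, J s -> deriv_in J u s (u1 s)) as Hu1 by apply Hu.
  assert (forall s, J s -> deriv_in J v s 0) as Hv1.
  { intros s Js.
    refine (deriv_in_ext _ _ _ _ _ _ Js _ eq_refl (deriv_in_const J c s)).
    intros y Jy; symmetry; auto. }
  pose proof (helicoidal_unit_speed _ _ _ _ _ _ _ _ (fun _ => 0) _
    Hg1 curve Hu1 Hv1) as unit.
  assert (forall s, J s -> u1 s * u1 s = 1) as unit'.
  { intros s Js; pose proof (unit s Js) as E; lra. }
  assert (forall s, J s -> u s <> 0) as u0.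
  { intros s Js E; apply A0; rewrite <- E; apply on, Js. }
  assert (forall s, J s -> deriv_in J u1 s 0) as Hu2.
  { intros s Js.
    assert (deriv_in J u1 s (u2 s)) as H by (apply Hu, Js).
    rewrite <- (deriv_constant_square J u1 1 s (u2 s) HJ Js); auto. }
  exists (fun s => (u1 s * cos c, u1 s * sin c, g1 (u s) * u1 s)).
  exists (fun s => (u1 s * - sin c, u1 s * cos c, 0)).
  (* kappa_n is the derivative of g'(u) u', namely g''(u) u'^2 = g''(u). *)
  exists (fun _ => 0), (fun s => g2 (u s)), (fun _ => 0).
  split; [|reflexivity].
  constructor; intros s Js.
  - pose proof (helicoidal_velocity A J g u v 0 s _ _ _
      (fun y Jy => proj1 (on y Jy)) Js (Hg1 _ (proj1 (on s Js)))
      (Hu1 s Js) (Hv1 s Js)) as H.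
    rewrite (vc s Js) in H.
    match type of H with is_vderiv _ _ _ ?p =>
      replace (u1 s * cos c, u1 s * sin c, g1 (u s) * u1 s) with p
        by (apply I3_eq; cbn; ring) end.
    exact H.
  - exists (cos c, sin c, g1 (u s)), (- u s * sin c, u s * cos c, 0).
    rewrite (vc s Js).
    pose proof (proj1 (on s Js)) as Au.
    split; [|split].
    + apply helicoidal_partial_u; auto.
    + apply (helicoidal_partial_v A _ _ _ _ (g1 (u s))); auto.
    (* The division is legitimate because the domain of [u] omits 0. *)
    + exists 0, (u1 s / u s).
      apply I3_eq; cbn; field; auto.
  - unfold iso_dot, x1, x2; cbn.
    transitivity (u1 s * u1 s * (cos c * cos c + sin c * sin c)); [ring|].
    rewrite unit', cos_sin_sqr by exact Js; ring.
  - unfold iso_dot, x1, x2; cbn; ring.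
  - unfold x1, x2; cbn.
    transitivity (u1 s * u1 s * (cos c * cos c + sin c * sin c)); [ring|].
    rewrite unit', cos_sin_sqr by exact Js; ring.
  - assert (deriv_in A g1 (u s) (g2 (u s))) as Hg2 by (apply Hg, on, Js).
    split; [|split]; cbn.
    + refine (deriv_in_ext _ _ _ _ _ _ Js (fun _ _ => eq_refl) _
        (deriv_in_mult _ _ _ _ _ _ (Hu2 s Js) (deriv_in_const _ _ _)));
        cbn; ring.
    + refine (deriv_in_ext _ _ _ _ _ _ Js (fun _ _ => eq_refl) _
        (deriv_in_mult _ _ _ _ _ _ (Hu2 s Js) (deriv_in_const _ _ _)));
        cbn; ring.
    + refine (deriv_in_ext _ _ _ _ _ _ Js (fun _ _ => eq_refl) _
        (deriv_in_mult _ _ _ _ _ _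
          (deriv_in_comp _ _ _ _ _ _ _ (fun y Jy => proj1 (on y Jy))
            (Hu1 s Js) Hg2) (Hu2 s Js))).
      cbn; rewrite Rmult_assoc, unit' by exact Js; ring.
  - split; [|split]; cbn.
    + refine (deriv_in_ext _ _ _ _ _ _ Js (fun _ _ => eq_refl) _
        (deriv_in_mult _ _ _ _ _ _ (Hu2 s Js) (deriv_in_const _ _ _)));
        cbn; ring.
    + refine (deriv_in_ext _ _ _ _ _ _ Js (fun _ _ => eq_refl) _
        (deriv_in_mult _ _ _ _ _ _ (Hu2 s Js) (deriv_in_const _ _ _)));
        cbn; ring.
    + refine (deriv_in_ext _ _ _ _ _ _ Js (fun _ _ => eq_refl) _
        (deriv_in_const _ 0 s)); cbn; ring.
Qed.

(** * A unit-speed parallel on a surface of arbitrary pitch *)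

Lemma class_C2_affine (D : R -> Prop) (a b : R) :
  class_C2 D (fun x => a * x + b).
Proof.
  exists (fun _ => a), (fun _ => 0).
  intros x Dx; split; [|split].
  - apply (deriv_in_ext D (fun y => a * y + b) _ x (0 * x + a * 1 + 0));
      [exact Dx|reflexivity|ring|].
    apply (deriv_in_plus D (fun y => a * y) (fun _ => b));
      [apply (deriv_in_mult D (fun _ => a) (fun y => y))|];
      auto using deriv_in_const, deriv_in_id.
  - apply deriv_in_const.
  (* Continuity of the second derivative, the zero function, follows from its differentiability. *)
  - exact (cont_deriv _ _ _ _ (deriv_in_const D 0 x)).
Qed.

(** The angular speed 1/c gives the circle of radius |c| in the top view unit speed, for either sign
    of [c]. The summand 0 matches the shape in [class_C2_affine]. *)
Lemma parallel_velocity (A : R -> Prop) (g : R -> R) (h c g' s : R) :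
  A c -> c <> 0 -> deriv_in A g c g' ->
  is_vderiv (fun _ => True) (fun y => helicoidal g h c (/ c * y + 0)) s
    (- sin (/ c * s), cos (/ c * s), h / c).
Proof.
  intros Ac c0 Hg.
  assert (deriv_in (fun _ => True) (fun y => / c * y + 0) s (/ c)) as Hv.
  { refine (deriv_in_ext (fun _ => True) _ _ _ _ _ Logic.I (fun _ _ => eq_refl) _
      (deriv_in_plus _ _ _ _ _ _
        (deriv_in_mult _ _ _ _ _ _ (deriv_in_const _ (/ c) s) (deriv_in_id _ s))
        (deriv_in_const _ 0 s))); cbn; ring. }
  pose proof (helicoidal_velocity A (fun _ => True) g (fun _ => c) _ h s _ _ _
    (fun _ _ => Ac) Logic.I Hg (deriv_in_const _ c s) Hv) as H.
  cbn in H; rewrite Rplus_0_r in H.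
  match type of H with is_vderiv _ _ _ ?p =>
    replace (- sin (/ c * s), cos (/ c * s), h / c) with p
      by (apply I3_eq; cbn; field; exact c0) end.
  exact H.
Qed.

Lemma parallel_arc_length_curve (A : R -> Prop) (g : R -> R) (h c g' : R) :
  A c -> c <> 0 -> deriv_in A g c g' ->
  arc_length_curve (helicoidal g h) A (fun _ => True) (fun _ => True)
    (fun _ => c) (fun s => / c * s + 0).
Proof.
  intros Ac c0 Hg.
  constructor.
  - split; [auto|].
    exists 0, 1; repeat split; lra.
  - auto.
  - exists (fun _ => 0), (fun _ => 0).
    intros x Dx; split; [|split].
    + apply deriv_in_const.
    + apply deriv_in_const.
    + exact (cont_deriv _ _ _ _ (deriv_in_const _ 0 x)).
  - apply class_C2_affine.
  - intros s _.
    exists (- sin (/ c * s), cos (/ c * s), h / c); split.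
    + exact (parallel_velocity A g h c g' s Ac c0 Hg).
    + unfold iso_dot, x1, x2; cbn.
      rewrite cos_sin_sqr; ring.
Qed.

(** The Darboux data are given only existentially, so [t] and [sigma] are first identified
    explicitly; comparing derivatives of sigma then gives kg = 1/c and 0 = - kg h/c + tg. *)
Lemma parallel_line_of_curvature_pitch (A : R -> Prop) (g : R -> R) (h c g' : R) :
  interval A -> A c -> c <> 0 -> deriv_in A g c g' ->
  line_of_curvature (helicoidal g h) A (fun _ => True) (fun _ => True)
    (fun _ => c) (fun s => / c * s + 0) ->
  h = 0.
Proof.
  intros HA Ac c0 Hg [t [sigma [kg [kn [tg [frame tg0]]]]]].
  assert (interval (fun _ => True)) as HT.
  { split; [auto|]; exists 0, 1; repeat split; lra. }
  assert (forall s, t s = (- sin (/ c * s), cos (/ c * s), h / c)) as Ht.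
  { intros s.
    exact (is_vderiv_unique _ _ _ _ _ HT Logic.I
      (darboux_t _ _ _ _ _ _ _ _ _ _ _ frame s Logic.I)
      (parallel_velocity A g h c g' s Ac c0 Hg)). }
  (* In sigma = a r_u + b r_v, orthogonality to [t] reads b c = 0 and the orientation condition
     reads -a = 1. *)
  assert (forall s, sigma s = (- cos (/ c * s), - sin (/ c * s), - g')) as Hsigma.
  { intros s.
    destruct (darboux_plane _ _ _ _ _ _ _ _ _ _ _ frame s Logic.I)
      as [Xu [Xv [HXu [HXv [a [b E]]]]]].
    pose proof (darboux_orth _ _ _ _ _ _ _ _ _ _ _ frame s Logic.I) as orth.
    pose proof (darboux_orient _ _ _ _ _ _ _ _ _ _ _ frame s Logic.I) as orient.
    rewrite Rplus_0_r in HXu, HXv.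
    rewrite (is_vderiv_unique _ _ _ _ _ HA Ac HXu
      (helicoidal_partial_u A g h c _ g' Ac Hg)) in E.
    rewrite (is_vderiv_unique _ _ _ _ _ HT Logic.I HXv
      (helicoidal_partial_v A g h c _ g' Ac Hg)) in E.
    rewrite Ht, E in orth, orient.
    unfold iso_dot, x1, x2 in orth, orient; cbn in orth, orient.
    pose proof (cos_sin_sqr (/ c * s)) as cs.
    assert (b * c = 0) as bc.
    { rewrite <- orth.
      transitivity (b * c * (cos (/ c * s) * cos (/ c * s)
        + sin (/ c * s) * sin (/ c * s))); [rewrite cs|]; ring. }
    assert (b = 0) as b0.
    { destruct (Rmult_integral _ _ bc); [assumption|contradiction]. }
    assert (a = -1) as a1.
    { assert (- (a * (cos (/ c * s) * cos (/ c * s)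
        + sin (/ c * s) * sin (/ c * s))) = 1) as E1.
      { rewrite <- orient, b0; ring. }
      rewrite cs in E1; lra. }
    rewrite E, a1, b0.
    apply I3_eq; cbn; ring. }
  (* At s = 0 the tangent has top view (0, 1): the first component carries no information, the
     second determines [kg 0], and the third then involves [h]. *)
  destruct (darboux_dsigma _ _ _ _ _ _ _ _ _ _ _ frame 0 Logic.I)
    as [_ [D2 D3]].
  assert (deriv_in (fun _ => True) (fun s => x2 (sigma s)) 0 (- / c)) as D2'.
  { refine (deriv_in_ext (fun _ => True) _ _ _ _ _ Logic.I _ _
      (deriv_in_mult _ _ _ _ _ _ (deriv_in_const _ (-1) 0)
        (deriv_in_sin _ _ _ _ (deriv_in_mult _ _ _ _ _ _
          (deriv_in_const _ (/ c) 0) (deriv_in_id _ 0))))).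
    - intros y _; rewrite Hsigma; cbn; ring.
    - cbn; rewrite Rmult_0_r, cos_0; ring. }
  assert (deriv_in (fun _ => True) (fun s => x3 (sigma s)) 0 0) as D3'.
  { refine (deriv_in_ext (fun _ => True) _ _ _ _ _ Logic.I _ eq_refl
      (deriv_in_const _ (- g') 0)).
    intros y _; rewrite Hsigma; reflexivity. }
  pose proof (deriv_in_unique _ _ _ _ _ HT Logic.I D2 D2') as E2.
  pose proof (deriv_in_unique _ _ _ _ _ HT Logic.I D3 D3') as E3.
  rewrite Ht, tg0 in E2, E3 by exact Logic.I.
  unfold x2, x3 in E2, E3; cbn in E2, E3.
  rewrite Rmult_0_r, cos_0 in E2.
  assert (kg 0 = / c) as Ekg by lra.
  rewrite Ekg in E3.
  (* The last factor is the left side of [E3]; multiplying it by -c^2 recovers [h]. *)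
  transitivity (- c * c * (- / c * (h / c) + 0 * 1)); [field; exact c0|].
  rewrite E3; ring.
Qed.

(** * Equivalence of the curvature-line condition with vanishing pitch *)

Theorem theorem4p3 (I : R -> Prop) (g : R -> R) (h : R)
    (hI : interval I) (hI0 : ~ I 0) (hg : class_C2 I g) :
  parameter_curves_are_lines_of_curvature (helicoidal g h) I (fun _ => True)
  <-> h = 0.
Proof.
  split.
  - intros H.
    destruct hg as [g1 [g2 Hg]].
    (* One parallel suffices, and nondegeneracy of [I] provides a radius parameter [c] for it. *)
    destruct (proj2 hI) as [c [_ [Ic _]]].
    assert (c <> 0) as c0 by (intros ->; exact (hI0 Ic)).
    assert (deriv_in I g c (g1 c)) as Hg1 by (apply Hg, Ic).
    apply (parallel_line_of_curvature_pitch I g h c (g1 c)); auto.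
    apply H.
    + exact (parallel_arc_length_curve I g h c (g1 c) Ic c0 Hg1).
    + left; exists c; reflexivity.
  - intros -> J u v curve [[c Hc]|[c Hc]].
    + exact (parallel_line_of_curvature I J g u v c hI0 hg curve Hc).
    + exact (meridian_line_of_curvature I J g u v c hI0 hg curve Hc).
Qed.
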